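(* Let $\mathcal{D}$ be a finite non-empty set. Then $(\mathcal{B}r(\mathcal{D}),\star)$ is a free non-associative permutative algebra.
   Context: $K$ is a field of characteristic zero; all vector spaces and algebras are over $K$. A (left) non-associative permutative algebra is a vector space $A$ with a bilinear product $\star:A\otimes A\to A$ such that $x\star(y\star z)=y\star(x\star z)$ for all $x,y,z\in A$. It is free if it is isomorphic to the free non-associative permutative algebra generated by some set (equivalently, by some vector space). $\mathcal{T}_P^{\mathcal{D}}$ is the set of planar rooted trees (finite, nonempty) whose vertices are decorated by elements of $\mathcal{D}$. For $d\in\mathcal{D}$ and $t_1,\ldots,t_n\in\mathcal{T}_P^{\mathcal{D}}$ ($n\ge 0$), $B_d(t_1\ldots t_n)$ is the planar rooted tree obtained by grafting $t_1,\ldots,t_n$, in this order from left to right, on a common root decorated by $d$. $\mathcal{B}r(\mathcal{D})=K\mathcal{T}_P^{\mathcal{D}}$ is the vector space with basis $\mathcal{T}_P^{\mathcal{D}}$ (the underlying space of the free brace algebra generated by $\mathcal{D}$). The bilinear product $\star$ on $\mathcal{B}r(\mathcal{D})$ is defined, for $t\in\mathcal{T}_P^{\mathcal{D}}$ and $t'=B_d(t_1\ldots t_n)\in\mathcal{T}_P^{\mathcal{D}}$, by $$t\star t'=\sum_{i=0}^n B_d(t_1\ldots t_i\,t\,t_{i+1}\ldots t_n).$$ *)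

(* Defs.v *)
From HB Require Import structures.
From mathcomp Require Import all_boot all_algebra.
From mathcomp Require Import finmap monalg.

Set Implicit Arguments.
Unset Strict Implicit.
Unset Printing Implicit Defensive.

Import GRing.Theory.
Local Open Scope ring_scope.

(* [Node d [:: t1; ...; tn]] is B_d(t1 ... tn); there is no empty tree. *)
Inductive ptree (D : Type) : Type := Node of D & seq (ptree D).

Section PtreeChoice.
Variable D : choiceType.

Fixpoint ptree_encode (t : ptree D) : GenTree.tree D :=
  let: Node d s := t in
  GenTree.Node 0 (GenTree.Leaf d :: [seq ptree_encode u | u <- s]).

Fixpoint ptree_decode (g : GenTree.tree D) : option (ptree D) :=
  if g is GenTree.Node _ (GenTree.Leaf d :: s) then
    Some (Node d (pmap ptree_decode s))
  else None.

Lemma ptree_encodeK : pcancel ptree_encode ptree_decode.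
Proof.
rewrite /pcancel; fix IH 1 => -[d s] /=; congr (Some (Node d _)).
elim: s => //= t s IHs; rewrite IH /=; congr cons; exact: IHs.
Qed.

HB.instance Definition _ := Choice.copy (ptree D) (pcan_type ptree_encodeK).

End PtreeChoice.

Section Brace.
Variables (K : fieldType) (D : choiceType).

(* The finitely supported functions on planar trees; << t >> is the basis
   element given by the tree t. *)
Definition Br : lmodType K := {malg K[ptree D]}.

Definition graft (t t' : ptree D) : Br :=
  let: Node d s := t' in
  \sum_(i < (size s).+1) << Node d (take i s ++ t :: drop i s) >>.

(* Bilinear extension of graft. *)
Definition star (x y : Br) : Br :=
  \sum_(t <- msupp x) \sum_(t' <- msupp y) (x@_t * y@_t') *: graft t t'.

Lemma starU (t t' : ptree D) : star << t >> << t' >> = graft t t'.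
Proof.
by rewrite /star !msuppU oner_eq0 !big_seq_fset1 !mcoeffU !eqxx mulr1 scale1r.
Qed.

End Brace.

Section NAP.
Variable K : fieldType.

(* [left_commutative m] is m x (m y z) = m y (m x z). *)
Definition is_nap (A : lmodType K) (m : A -> A -> A) : Prop :=
  [/\ forall y, linear (m^~ y), forall x, linear (m x) & left_commutative m].

(* (A, m) together with j : X -> A is the free non-associative permutative
   algebra generated by the set X; the universal property determines it up to
   unique isomorphism. *)
Definition is_free_nap_on (X : Type) (A : lmodType K) (m : A -> A -> A)
    (j : X -> A) : Prop :=
  is_nap m /\
  forall (B : lmodType K) (mB : B -> B -> B), is_nap mB ->
  forall f : X -> B,
  exists phi : {linear A -> B},
    [/\ {morph phi : x y / m x y >-> mB x y},
        forall a, phi (j a) = f a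
      & forall psi : {linear A -> B},
          {morph psi : x y / m x y >-> mB x y} ->
          (forall a, psi (j a) = f a) -> psi =1 phi].

Definition is_free_nap (A : lmodType K) (m : A -> A -> A) : Prop :=
  exists (X : Type) (j : X -> A), is_free_nap_on m j.

End NAP.

(* Main.v *)
Require Import Defs.
From HB Require Import structures.
From mathcomp Require Import all_boot all_algebra.
From mathcomp Require Import finmap monalg.

Set Implicit Arguments.
Unset Strict Implicit.
Unset Printing Implicit Defensive.

Import GRing.Theory.
Local Open Scope ring_scope.

(** A tree B_d(w) is a root decorated by d carrying a word w of trees, and
    s * B_d(w) is the sum of the B_d(v) for v running over the insertions of
    the letter s into w. Let the trees be totally ordered (by a key in nat) and
    the words of a given length be ordered lexicographically. Among the
    insertions of s into w, the largest is [top s w], where s is placed just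
    before the first letter smaller than s. Hence
        s * B_d(w) = c B_d(top s w) + (smaller trees),
    where the multiplicity c is a positive integer, invertible in K. The
    generators are the trees whose word of children is not of the form
    [top s w]; every other tree is expressed, by the displayed equation, through
    a product of trees with fewer vertices and through smaller trees. So a
    morphism is determined by its values on the generators, and given such
    values the equation, used for one chosen pair (s, w) per tree, defines a
    linear map by well-founded recursion ([graft_morphism_exists]).

    It remains to see that this map respects all the products s * B_d(w) and
    not only the chosen ones. Suppose that top s w = top r w1 where (r, w1) is
    the chosen pair and r <> s. Then w = top r w0 and w1 = top s w0 for some w0
    ([top_confluence]). Comparing r * (s * B_d(w0)) with s * (r * B_d(w0)),
    which agree both in the brace algebra ([insertionsC]) and in the target,
    gives the product s * B_d(w) from products with smaller leading tree, since
    [top] is strictly increasing in the word ([top_mono]). This is the argument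
    of [extension_step_morphism]: all overlaps between the rewriting rules are
    resolved by the permutative identity itself.

    The keys exist as soon as the set of decorations is countable, and
    [brace_free_nap] is stated at this level. *)

(** * Linear maps given as functions *)

Section LinearFunctions.
Variables (K : fieldType) (U V : lmodType K) (f : U -> V).
Hypothesis lin_f : linear f.

Let L : {linear U -> V} := HB.pack f (GRing.isLinear.Build _ _ _ _ f lin_f).

Lemma linear_fun_sum I (l : seq I) (P : pred I) (E : I -> U) :
  f (\sum_(i <- l | P i) E i) = \sum_(i <- l | P i) f (E i).
Proof. exact: (linear_sum L). Qed.

Lemma linear_funZ c x : f (c *: x) = c *: f x.
Proof. exact: (linearZZ L). Qed.

Lemma linear_funD x y : f (x + y) = f x + f y.
Proof. exact: (linearD L). Qed.
End LinearFunctions.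

(** * Inserting a letter into a word *)

Section Words.
Variables (T : eqType) (key : T -> nat).
Hypothesis key_inj : injective key.
Implicit Types (r s x y : T) (u v w : seq T).

(** The list of insertions has one entry per position, so an insertion obtained
    at several positions is repeated; the multiplicities are the coefficients
    of the product. *)
Fixpoint insertions s w : seq (seq T) :=
  if w is x :: w' then (s :: w) :: [seq x :: v | v <- insertions s w']
  else [:: [:: s]].

Fixpoint top s w : seq T :=
  if w is x :: w' then if (key x < key s)%N then s :: w else x :: top s w'
  else [:: s].

(** Meant for words of equal length; a word and its proper prefixes are not
    comparable. *)
Fixpoint lexlt u v : bool :=
  match u, v with
  | x :: u', y :: v' => (key x < key y)%N || (x == y) && lexlt u' v'
  | _, _ => false
  end.

Lemma big_insertions_cons (V : zmodType) (F : seq T -> V) s x w :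
  \sum_(v <- insertions s (x :: w)) F v =
  F [:: s, x & w] + \sum_(v <- insertions s w) F (x :: v).
Proof. by rewrite big_cons big_map. Qed.

Lemma big_insertions_nth (V : zmodType) (F : seq T -> V) s w :
  \sum_(i < (size w).+1) F (take i w ++ s :: drop i w) =
  \sum_(v <- insertions s w) F v.
Proof.
elim: w F => [|x w IHw] F.
  by rewrite big_ord_recl big_ord0 big_seq1 addr0.
by rewrite big_insertions_cons -IHw big_ord_recl.
Qed.

(** The permutative identity of the product, tested against an arbitrary
    function F: whether r or s comes first, the double insertions give every
    word in which r and s are placed around the letters of w, with the same
    multiplicities. *)
Lemma insertionsC (V : zmodType) (F : seq T -> V) r s w :
  \sum_(u <- insertions r w) \sum_(v <- insertions s u) F v =
  \sum_(u <- insertions s w) \sum_(v <- insertions r u) F v.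
Proof.
elim: w F => [|x w IHw] F.
  by rewrite !big_seq1 /= !big_cons !big_nil /= !addr0 addrC.
have expand a b :
  \sum_(u <- insertions a (x :: w)) \sum_(v <- insertions b u) F v
  = F [:: b, a, x & w] + (F [:: a, b, x & w]
      + \sum_(v <- insertions b w) F [:: a, x & v]
      + \sum_(u <- insertions a w) F [:: b, x & u])
    + \sum_(u <- insertions a w) \sum_(v <- insertions b u) F (x :: v).
  rewrite big_insertions_cons !big_insertions_cons.
  under [X in _ + X]eq_bigr do rewrite big_insertions_cons.
  by rewrite big_split /= !addrA.
(* The expansion is symmetric in a and b up to the order of its terms. *)
rewrite !expand (IHw (fun v => F (x :: v))); congr (_ + _).
rewrite !addrA (addrC (F [:: s, r, x & w])) -!addrA; congr (_ + (_ + _)).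
by rewrite addrC.
Qed.

Lemma perm_insertions s w v : v \in insertions s w -> perm_eq v (s :: w).
Proof.
elim: w v => [|x w IHw] v; first by rewrite inE => /eqP->.
rewrite inE => /orP[/eqP-> // | /mapP[u /IHw pu ->]].
rewrite -(perm_cons x) in pu; apply: perm_trans pu _.
exact: (permEl (perm_catCA [:: x] [:: s] w)).
Qed.

Lemma top_insertion s w : top s w \in insertions s w.
Proof.
elim: w => [|x w IHw] /=; first exact: mem_head.
by case: ifP => _; rewrite inE ?eqxx // (map_f (cons x)) ?orbT.
Qed.

Lemma size_top s w : size (top s w) = (size w).+1.
Proof. by rewrite (perm_size (perm_insertions (top_insertion s w))). Qed.

(** When s may not be placed before x, that is when x is at least s, placing it
    before x is no gain over continuing to the right of x: along a run of
    letters equal to s the choice does not matter, and the first letter that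
    differs decides. *)
Lemma top_ge_head s x w : lexlt (s :: x :: w) (x :: top s w) ||
  (s :: x :: w == x :: top s w) || (key x < key s)%N.
Proof.
elim: w x => [|y w IHw] x /=; case: (ltngtP (key x) (key s)) => [||/key_inj ->];
  rewrite ?orbT //=; first by rewrite (eqxx [:: s; s]) orbT.
rewrite eqxx; case: ifP => ys; first by rewrite (eqxx [:: s, s, y & w]) orbT.
have := IHw y; rewrite ys orbF => /orP[/= ->|/eqP->] //.
by rewrite (eqxx (s :: _)) orbT.
Qed.

Lemma insertions_le_top s w v :
  v \in insertions s w -> v != top s w -> lexlt v (top s w).
Proof.
elim: w v => [|x w IHw] v; first by rewrite inE => ->.
rewrite inE => /orP[/eqP-> | /mapP[u uw ->]] /=.
  case: ifP => [|xs]; first by rewrite eqxx.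
  have := top_ge_head s x w; rewrite xs orbF.
  by move=> /orP[// | /eqP->]; rewrite eqxx.
case: ifP => [/= -> //|_]; rewrite eqseq_cons eqxx /= => /IHw -> //.
by rewrite orbT.
Qed.

(** [top s] is the maximum of the insertions of s; strict monotonicity is what
    lets a product with s of smaller terms have a smaller leading word. *)
Lemma top_mono s u v :
  size u = size v -> lexlt u v -> lexlt (top s u) (top s v).
Proof.
elim: u v => [|x u IHu] [|y v] //= [suv].
case/orP=> [xy|/andP[/eqP<- uv]].
  case: ifP => xs; case: ifP => ys /=; rewrite ?xy ?eqxx ?orbT //; last first.
    by rewrite (ltn_trans xy ys) in xs.
  case: (ltngtP (key s) (key y)) ys => //= /key_inj-> _; rewrite eqxx.
  case: v {IHu suv} => [|z v] /=; first by rewrite xy.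
  case: ifP => /= zs; first by rewrite xy.
  by rewrite (leq_trans xy) // leqNgt zs.
by case: ifP => _ /=; rewrite !eqxx ?uv ?(IHu v) ?orbT.
Qed.

Lemma top_head s w x u : top s w = x :: u -> (key s <= key x)%N.
Proof.
case: w => [|y w] /=; first by case=> -> _.
by case: ltnP => [_ [-> _] | sy [<- _]].
Qed.

Lemma top_inj s : injective (top s).
Proof.
move=> u v e; have /eqP: size (top s u) = size (top s v) by rewrite e.
rewrite !size_top eqSS => /eqP suv.
elim: u v suv e => [|x u IHu] [|y v] //= [suv].
case: ifP => xs; case: ifP => ys [].
- by move=> -> ->.
- by move=> _ /esym/top_head; rewrite leqNgt xs.
- by move=> _ /top_head; rewrite leqNgt ys.
- by move=> -> /(IHu _ suv)->.
Qed.

(** In the common word, s is the last letter of the longest prefix with letters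
    at least s, and likewise for r. These are two different positions, and the
    two letters can be removed in either order. *)
Lemma top_confluence r s u v : r != s -> top s u = top r v ->
  exists2 w, u = top r w & v = top s w.
Proof.
(* The case where a is placed at once and b further right: the letter y kept
   in front of b is then the a that was placed. *)
have diff a b x y p q : a != b -> (key x < key a)%N ->
    a :: x :: p = y :: top b q -> (key b <= key y)%N ->
  x :: p = top b q /\ y :: q = top a q.
  move=> ab xa [ay e] kb; split=> //.
  case: q e => [|z q] /=; first by rewrite ay.
  case: ltnP => [zb _|zb [<- _]]; last by rewrite xa ay.
  by rewrite (leq_trans zb) ?ay.
elim: u v => [|x u IHu] [|y v] rs /=.
- by case=> sr; rewrite sr eqxx in rs.
- by case: ifP => _ //; case: v => //= ? ?; case: ifP.
- by case: ifP => _ //; case: u {IHu} => //= ? ?; case: ifP.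
case: ltnP => xs; case: ltnP => yr.
- by case=> sr; rewrite sr eqxx in rs.
- rewrite eq_sym in rs; move=> /(diff _ _ _ _ _ _ rs xs)/(_ yr)[-> ->].
  by exists v.
- by move=> /esym/(diff _ _ _ _ _ _ rs yr)/(_ xs)[-> ->]; exists u.
case=> xy /(IHu _ rs)[w -> ->]; exists (x :: w); rewrite /= ltnNge.
  by rewrite xy yr.
by rewrite xs xy.
Qed.

(** Fixing the length matters: with a < b the words b, ab, aab, ... would form
    an infinite descending chain. *)
Lemma lexlt_wf : well_founded (fun u v => (size u == size v) && lexlt u v).
Proof.
move=> u; move En: (size u) => n; elim: n u En => [|n IHn] u En.
  apply: Acc_intro => v /andP[_]; rewrite (size0nil En).
  by case: v.
case: u En => [|x u]; [discriminate|case=> Eu]; move Ek: (key x) => k.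
elim/ltn_ind: k x Ek u Eu => k IHk x Ek u Eu.
have accu := IHn u Eu; elim: accu Eu => {}u _ IHu Eu.
apply: Acc_intro => v /andP[].
case: v => [|y v]; first by [].
rewrite /= eqSS => /eqP svu /orP[yx | /andP[/eqP-> vu]].
  by apply: (IHk (key y)); rewrite -?Ek ?svu.
by apply: IHu; rewrite ?svu ?eqxx.
Qed.

End Words.

(** * Well-founded recursion with a locality hypothesis *)

(** The step [body] may look at the whole function, as long as its value at t
    depends only on the values below t; this avoids proof-carrying arguments in
    the definition of the step. *)
Lemma wf_recursion (T : Type) (V : Type) (v0 : V) (R : rel T)
    (body : (T -> V) -> T -> V) :
  well_founded R ->
  (forall F G t, (forall t', R t' t -> F t' = G t') -> body F t = body G t) ->
  exists F, forall t, F t = body F t.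
Proof.
move=> wfR local.
(* Calls that are not below t receive the default value v0. *)
pose ext t (G : forall t', R t' t -> V) t' :=
  if @idP (R t' t) is ReflectT h then G t' h else v0.
pose F := Fix wfR (fun=> V) (fun t G => body (ext t G) t).
exists F => t; rewrite /F Fix_eq => [|{}t G H GH];
  apply: local => t'; rewrite /ext.
  by case: {-}_ / idP => // h; rewrite GH.
by case: {-}_ / idP.
Qed.

(** * Leading trees *)

Section Trees.
Variable D : countType.
Implicit Types (d : D) (s t : ptree D) (u v w : seq (ptree D)).

Definition tree_key t : nat := @choice.pickle (GenTree.tree D) (ptree_encode t).

Lemma tree_key_inj : injective tree_key.
Proof.
by move=> t t' /(pcan_inj choice.pickleK)/(pcan_inj (@ptree_encodeK D)).
Qed.

Local Notation top := (top tree_key).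
Local Notation lexlt := (lexlt tree_key).

Fixpoint vertices t : nat :=
  let: Node _ w := t in (sumn [seq vertices s | s <- w]).+1.

Definition children t : seq (ptree D) := let: Node _ w := t in w.

(** A product with B_d(w) only involves trees with root d, so the comparison
    looks at the children alone. *)
Definition smaller t' t : bool :=
  (vertices t' < vertices t)%N ||
  [&& vertices t' == vertices t, size (children t') == size (children t)
    & lexlt (children t') (children t)].

Lemma smaller_wf : well_founded smaller.
Proof.
move=> t; move En: (vertices t) => n; elim/ltn_ind: n t En => n IHn t.
move Eu: (children t) => u.
elim: (lexlt_wf tree_key u) t Eu => {}u _ IHu t Eu En.
apply: Acc_intro => t'; rewrite /smaller En Eu.
case/orP=> [vt' | /and3P[/eqP vt' st' lt']]; first exact: IHn vt' _ (erefl _).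
by apply: (IHu (children t')); rewrite ?st'.
Qed.

Lemma vertices_insertion d s w v : v \in insertions s w ->
  vertices (Node d v) = (vertices s + vertices (Node d w))%N.
Proof.
by move=> /perm_insertions/(perm_map vertices)/perm_sumn /= ->; rewrite addnS.
Qed.

Lemma vertices_gt0 t : (0 < vertices t)%N. Proof. by case: t. Qed.

Lemma smaller_insertion d s w v : v \in insertions s w -> v != top s w ->
  smaller (Node d v) (Node d (top s w)).
Proof.
move=> vI vtop; have topI := top_insertion tree_key s w.
rewrite /smaller (vertices_insertion d vI) (vertices_insertion d topI) eqxx /=.
rewrite (perm_size (perm_insertions vI)) (perm_size (perm_insertions topI)).
rewrite eqxx.
by rewrite (insertions_le_top tree_key_inj) ?orbT.
Qed.

Lemma smaller_left d s w : smaller s (Node d (top s w)).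
Proof.
rewrite /smaller (vertices_insertion d (top_insertion _ _ _)).
by rewrite -[X in (X < _)%N]addn0 ltn_add2l vertices_gt0.
Qed.

Lemma smaller_right d s w : smaller (Node d w) (Node d (top s w)).
Proof.
rewrite /smaller (vertices_insertion d (top_insertion _ _ _)).
by rewrite -[X in (X < _)%N]add0n ltn_add2r vertices_gt0.
Qed.

Lemma smaller_top d s u v : v \in insertions s u -> v != top s u -> forall r,
  smaller (Node d (top r v)) (Node d (top r (top s u))).
Proof.
move=> vI vtop r; have topI := top_insertion tree_key.
have sz : size v = (size u).+1 by rewrite (perm_size (perm_insertions vI)).
rewrite /smaller !(vertices_insertion d (topI _ _)) (vertices_insertion d vI).
rewrite eqxx /=.
by rewrite !size_top sz eqxx !(top_mono, insertions_le_top) ?size_top ?orbT //;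
  exact: tree_key_inj.
Qed.

(** Encodes the chosen pair (s, v) with top s v = w as the word [s :: v], and
    its absence as the empty word. The search ranges over [permutations w]
    because [top s v] is a permutation of [s :: v]. *)
Definition untop w : seq (ptree D) :=
  head [::] [seq u <- permutations w |
    if u is s :: v then top s v == w else false].

Lemma untopP w :
  if untop w is s :: v then top s v = w else forall s v, top s v != w.
Proof.
rewrite /untop; set p := fun u => _.
have pE u : u \in [seq u <- permutations w | p u] -> p u.
  by rewrite mem_filter => /andP[].
case E: [seq u <- permutations w | p u] pE => [|u l] /= pE; last first.
  by have := pE u (mem_head u l); case: u {E pE} => //= s v /eqP.
move=> s v; apply/negP=> sv.
have: s :: v \in [seq u <- permutations w | p u].
  rewrite mem_filter /= sv mem_permutations perm_sym -(eqP sv).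
  exact: perm_insertions (top_insertion _ _ _).
by rewrite E.
Qed.

(** The trees that are the leading term of no product of two trees. *)
Definition generator t : bool := nilp (untop (children t)).

(** * Extending a map defined on the generators *)

Section Extension.
Variables (K : fieldType) (charK : [pchar K] =i pred0).
Variables (B : lmodType K) (mB : B -> B -> B).
Hypothesis mB_nap : is_nap mB.
Let mB_linear x : linear (mB x). Proof. by case: mB_nap. Qed.
Implicit Types F G : ptree D -> B.

(** The value at s * B_d(w) of the linear extension of F. *)
Definition graft_sum F d s w : B := \sum_(v <- insertions s w) F (Node d v).

(** One more than the number of consecutive letters s that precede the place
    where s is put; invertible because the characteristic is zero. *)
Definition lead_coeff s w : K := (count_mem (top s w) (insertions s w))%:R.

Definition tail_sum F d s w : B :=
  \sum_(v <- insertions s w | v != top s w) F (Node d v).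

Definition graft_morphism F : Prop :=
  forall d s w, graft_sum F d s w = mB (F s) (F (Node d w)).

Lemma lead_coeff_neq0 s w : lead_coeff s w != 0.
Proof.
rewrite /lead_coeff ((pcharf0P K).1 charK) -lt0n -has_count has_pred1.
exact: top_insertion.
Qed.

Lemma big_insertions_top (H : seq (ptree D) -> B) s w :
  \sum_(v <- insertions s w) H v =
  lead_coeff s w *: H (top s w) + \sum_(v <- insertions s w | v != top s w) H v.
Proof.
rewrite (bigID (pred1 (top s w))) /=; congr (_ + _).
rewrite (eq_bigr (fun=> H (top s w))) => [|v /eqP-> //].
by rewrite big_const_seq iter_addr_0 scaler_nat.
Qed.

(** The functions fixed by this step satisfy the product equation of each chosen
    pair: it is solved here for its leading term. *)
Definition extension_step (f0 : ptree D -> B) F t : B :=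
  let: Node d w := t in
  if untop w is s :: v then
    (lead_coeff s v)^-1 *: (mB (F s) (F (Node d v)) - tail_sum F d s v)
  else f0 t.

Lemma extension_stepE f0 F d s w : untop (top s w) = s :: w ->
  F (Node d (top s w)) = extension_step f0 F (Node d (top s w)) <->
  graft_sum F d s w = mB (F s) (F (Node d w)).
Proof.
rewrite /graft_sum big_insertions_top /= => ->; split=> [->|<-].
  by rewrite scalerA divff ?lead_coeff_neq0 // scale1r subrK.
by rewrite addrK scalerA mulVf ?lead_coeff_neq0 // scale1r.
Qed.

Lemma extension_step_local f0 F G t :
  (forall t', smaller t' t -> F t' = G t') ->
  extension_step f0 F t = extension_step f0 G t.
Proof.
case: t => d w FG /=; case: (untop w) (untopP w) => // s v Ew.
rewrite -{w}Ew in FG *.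
rewrite (FG s) ?smaller_left // (FG (Node d v)) ?smaller_right //.
congr (_ *: (_ - _)); rewrite /tail_sum big_seq_cond [RHS]big_seq_cond.
by apply: eq_bigr => u /andP[uI utop]; rewrite FG // smaller_insertion.
Qed.

(** Only the product equations of the chosen pairs hold by construction. The
    other ones follow by induction on the leading tree, by computing the double
    insertion of r and s into w0 in the two possible orders. *)
Lemma extension_step_morphism f0 F :
  (forall t, F t = extension_step f0 F t) -> graft_morphism F.
Proof.
move=> FE d s w; move Et: (Node d (top s w)) => t.
elim/(well_founded_ind smaller_wf): t d s w Et => t IHt d s w Et.
have IH s' w' : smaller (Node d (top s' w')) (Node d (top s w)) ->
    graft_sum F d s' w' = mB (F s') (F (Node d w')).
  by rewrite Et => /IHt; apply.
case E: (untop (top s w)) (untopP (top s w)) => [|r w1] topE.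
  by have:= topE s w; rewrite eqxx.
have canon : graft_sum F d r w1 = mB (F r) (F (Node d w1)).
  by apply/(extension_stepE f0); rewrite ?topE.
have [rs|rs] := eqVneq r s.
  by rewrite rs in topE canon; rewrite -(top_inj topE).
have [w0 wE w1E] := top_confluence rs (esym topE).
(* All terms but the leading one have a smaller leading tree, and the leading
   one is the chosen pair. *)
have viaR : \sum_(u <- insertions s w0) graft_sum F d r u =
    mB (F r) (mB (F s) (F (Node d w0))).
  rewrite -IH; last by rewrite -topE w1E smaller_right.
  rewrite (linear_fun_sum (mB_linear (F r))); apply: eq_big_seq => u uI.
  have [->|utop] := eqVneq u (top s w0); first by rewrite -w1E.
  by apply: IH; rewrite -topE w1E (smaller_top _ uI).
have viaS : \sum_(u <- insertions r w0) graft_sum F d s u =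
    mB (F s) (mB (F r) (F (Node d w0))).
  by rewrite insertionsC viaR; case: mB_nap.
(* In the other order, every term except the one sought is known by
   induction; cancelling them leaves the equation for s and w. *)
rewrite -IH in viaS; last by rewrite wE smaller_right.
rewrite [graft_sum F d r w0]/graft_sum !big_insertions_top in viaS.
rewrite (linear_funD (mB_linear (F s))) in viaS.
rewrite (linear_funZ (mB_linear (F s))) in viaS.
rewrite (linear_fun_sum (mB_linear (F s))) -wE in viaS.
apply: (scalerI (lead_coeff_neq0 r w0)); apply: (addIr _ (etrans viaS _)).
congr (_ + _); rewrite big_seq_cond [RHS]big_seq_cond.
apply: eq_bigr => u /andP[uI utop]; apply/esym/IH.
by rewrite wE (smaller_top _ uI) -?wE.
Qed.

Lemma graft_morphism_step f0 F t : graft_morphism F ->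
  (generator t -> F t = f0 t) -> F t = extension_step f0 F t.
Proof.
move=> FM; case: t => d w; rewrite /generator /=.
case E: (untop w) (untopP w) => [|s v] /= Ew; first exact.
move=> _; rewrite -Ew in E *; rewrite [LHS](extension_stepE f0 F d E).2 //=.
by rewrite E.
Qed.

Lemma graft_morphism_unique F G : graft_morphism F -> graft_morphism G ->
  (forall t, generator t -> F t = G t) -> F =1 G.
Proof.
move=> FM GM FG t; elim/(well_founded_ind smaller_wf): t => t IHt.
rewrite (graft_morphism_step FM (FG t)) (graft_morphism_step (f0 := G) GM) //.
exact: extension_step_local.
Qed.

Lemma graft_morphism_exists f0 : exists2 F, graft_morphism F &
  forall t, generator t -> F t = f0 t.
Proof.
have [F FE] := wf_recursion 0 smaller_wf (@extension_step_local f0).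
exists F; first exact: extension_step_morphism FE.
by case=> d w; rewrite FE /generator /=; case: (untop w).
Qed.

End Extension.
End Trees.

(** * Linear extension from a basis *)

Section LinearExtension.
Variables (K : fieldType) (T : choiceType).
Implicit Types (x y : {malg K[T]}) (t : T).

Section Extend.
Variable V : lmodType K.
Implicit Types g : T -> V.

Definition linext g x : V := \sum_(t <- msupp x) x@_t *: g t.

Lemma linextEw g x (E : {fset T}) : (msupp x `<=` E)%fset ->
  linext g x = \sum_(t <- E) x@_t *: g t.
Proof.
move=> xE; apply: big_fset_incl => // t _ /mcoeff_outdom ->.
exact: scale0r.
Qed.

Lemma linextU g t : linext g << t >> = g t.
Proof. by rewrite /linext msuppU oner_eq0 big_seq_fset1 mcoeffUU scale1r. Qed.

Lemma linext_is_linear g : linear (linext g).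
Proof.
move=> a x y; pose E := (msupp x `|` msupp y)%fset.
have xE : (msupp x `<=` E)%fset by exact: fsubsetUl.
have yE : (msupp y `<=` E)%fset by exact: fsubsetUr.
have axyE : (msupp (a *: x + y) `<=` E)%fset.
  by apply: fsubset_trans (msuppD_le _ _) (fsetSU _ (msuppZ_le _ _)).
rewrite (linextEw g xE) (linextEw g yE) (linextEw g axyE).
rewrite scaler_sumr -big_split.
by apply: eq_bigr => t _; rewrite mcoeffD mcoeffZ scalerDl scalerA.
Qed.

HB.instance Definition _ g := GRing.isLinear.Build K {malg K[T]} V _ (linext g)
  (linext_is_linear g).

Lemma eq_linext g h : g =1 h -> linext g =1 linext h.
Proof. by move=> gh x; apply: eq_bigr => t _; rewrite gh. Qed.

Lemma linext_lin g h a x :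
  linext (fun t => a *: g t + h t) x = a *: linext g x + linext h x.
Proof.
rewrite /linext scaler_sumr -big_split; apply: eq_bigr => t _ /=.
by rewrite scalerDr !scalerA mulrC.
Qed.

End Extend.

Lemma linext_basis x : x = linext (fun t => << t >>) x.
Proof.
rewrite {1}[x]monalgE; apply: eq_bigr => t _; apply/malgP => t'.
by rewrite mcoeffZ !mcoeffU mulrnAr mulr1.
Qed.

Lemma linear_linext (U V : lmodType K) (f : U -> V) (g : T -> U) x :
  linear f -> f (linext g x) = linext (fun t => f (g t)) x.
Proof.
move=> lin_f; rewrite /linext linear_fun_sum //.
by apply: eq_bigr => t _; rewrite linear_funZ.
Qed.

Lemma linear_basis_ext (V : lmodType K) (f g : {malg K[T]} -> V) :
  linear f -> linear g -> (forall t, f << t >> = g << t >>) -> f =1 g.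
Proof.
move=> lin_f lin_g fg x; rewrite [x]linext_basis !linear_linext //.
exact: eq_linext.
Qed.
End LinearExtension.

(** * Freeness *)

Section Free.
Variables (K : fieldType) (D : countType).
Local Notation Br := (Br K D).
Local Notation star := (@star K D).

Lemma linext_graft (V : lmodType K) (F : ptree D -> V) s d w :
  linext F (graft K s (Node d w)) = graft_sum F d s w.
Proof.
rewrite /graft linear_sum /graft_sum.
rewrite -(big_insertions_nth (fun v => F (Node d v))).
by apply: eq_bigr => i _; rewrite /= linextU.
Qed.

Lemma starE (x y : Br) :
  star x y = linext (fun s => linext (graft K s) y) x.
Proof.
apply: eq_bigr => s _; rewrite scaler_sumr.
by apply: eq_bigr => t _; rewrite scalerA.
Qed.

Lemma star_linear_r (x : Br) : linear (star x).
Proof.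
move=> a y z; rewrite (starE x (a *: y + z)) (starE x y) (starE x z).
apply: etrans (linext_lin _ _ _ _); apply: eq_linext => s; exact: linearP.
Qed.

Lemma star_linear_l (y : Br) : linear (star^~ y).
Proof.
move=> a x z /=; rewrite (starE (a *: x + z)) (starE x) (starE z).
exact: linearP.
Qed.

Lemma graftE s d w :
  graft K s (Node d w) = graft_sum (fun t => << t >> : Br) d s w.
Proof. exact: (big_insertions_nth (fun v => << Node d v >> : Br)). Qed.

Lemma star_nap : is_nap star.
Proof.
split; [exact: star_linear_l | exact: star_linear_r | move=> x y z].
have basis (s r t : ptree D) :
    star << s >> (star << r >> << t >>) = star << r >> (star << s >> << t >>).
  case: t => d w; rewrite (starU K r (Node d w)) (starU K s (Node d w)).
  rewrite !graftE /graft_sum.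
  rewrite (linear_fun_sum (star_linear_r << s >>)).
  rewrite (linear_fun_sum (star_linear_r << r >>)).
  under [LHS]eq_bigr do rewrite (starU K s) graftE.
  under [RHS]eq_bigr do rewrite (starU K r) graftE.
  exact: (insertionsC (fun v => << Node d v >> : Br)).
have comp_l a b : linear (fun c => star a (star c b)).
  by move=> k u v; rewrite (star_linear_l b k u v) (star_linear_r a).
have comp_r a b : linear (fun c => star a (star b c)).
  by move=> k u v; rewrite (star_linear_r b) (star_linear_r a).
have lin_l := star_linear_l.
apply: (linear_basis_ext (lin_l (star y z)) (comp_l y z)) => s.
apply: (linear_basis_ext (comp_l << s >> z) (lin_l (star << s >> z))) => r.
exact: (linear_basis_ext (comp_r << s >> << r >>) (comp_r << r >> << s >>)).
Qed.

Theorem brace_free_nap (charK : [pchar K] =i pred0) : is_free_nap star.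
Proof.
exists {t : ptree D | generator t}, (fun a => << val a >>).
split; first exact: star_nap.
move=> B mB mB_nap f.
pose f0 t := if insub t is Some a then f a else 0.
have [F FM Ff0] := graft_morphism_exists charK mB_nap f0.
have Ff a : F (val a) = f a by rewrite Ff0 ?(valP a) // /f0 valK.
have [mBl mBr _] := mB_nap.
exists (linext F); split=> [x y | a | psi psiM psij].
- rewrite starE (linear_linext _ _ (linearP _)) (linear_linext _ _ (mBl _)).
  apply: eq_linext => s; rewrite (linear_linext _ _ (linearP _)).
  rewrite (linear_linext _ _ (mBr _)); apply: eq_linext => -[d w].
  exact: etrans (linext_graft F s d w) (FM d s w).
- exact: etrans (linextU F _) (Ff a).
apply: linear_basis_ext; [exact: linearP | exact: linearP | move=> t].
apply: etrans (esym (linextU F t)).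
have psi_graft : graft_morphism mB (fun s => psi << s >>).
  move=> d s w; rewrite -(psiM << s >> << Node d w >>) (starU K s (Node d w)).
  by rewrite graftE linear_sum.
have psi_gen s : generator s -> psi << s >> = F s.
  move=> gs; exact: etrans (psij (exist _ s gs)) (esym (Ff (exist _ s gs))).
exact: (graft_morphism_unique charK psi_graft FM psi_gen t).
Qed.
End Free.

Theorem theorem9 (K : fieldType) (charK : [pchar K] =i pred0)
  (D : finType) (D_gt0 : (0 < #|D|)%N) :
  is_free_nap (@star K D).
Proof. exact: brace_free_nap charK. Qed.
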